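(* Let $\Lambda\subset\mathbb R^2$ be a unimodular lattice, $\tau>0$ with $\mathcal F(\Lambda,\tau)\ne\emptyset$, and let $\begin{pmatrix}q_1 \\ a_1\end{pmatrix},\begin{pmatrix}q_2 \\ a_2\end{pmatrix},\begin{pmatrix}q_3 \\ a_3\end{pmatrix}\in\mathcal F(\Lambda,\tau)$ be three primitive points with consecutive slopes. Then $$\begin{pmatrix}q_3 \\ a_3\end{pmatrix}=k\begin{pmatrix}q_2 \\ a_2\end{pmatrix}-\begin{pmatrix}q_1 \\ a_1\end{pmatrix},\qquad k=\left\lfloor\frac{\tau+q_1}{q_2}\right\rfloor,$$ and $$\begin{pmatrix}q_1 \\ a_1\end{pmatrix}=k'\begin{pmatrix}q_2 \\ a_2\end{pmatrix}-\begin{pmatrix}q_3 \\ a_3\end{pmatrix},\qquad k'=\left\lfloor\frac{\tau+q_3}{q_2}\right\rfloor.$$ In particular $\dfrac{a_2}{q_2}=\dfrac{a_1+a_3}{q_1+q_3}$.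
   Context: A unimodular lattice $\Lambda\subset\mathbb R^2$ is a lattice of covolume $1$. A nonzero $v\in\Lambda$ is primitive if the only lattice point in $\{rv\mid r\in[0,1)\}$ is the origin; $\Lambda_{\mathrm{prim}}$ is the set of primitive points. $S_\tau=(0,\tau]\times\mathbb R$ and $\mathcal F(\Lambda,\tau)=\Lambda_{\mathrm{prim}}\cap S_\tau$. The slope of $\begin{pmatrix}q \\ a\end{pmatrix}$ is $a/q$. Two points $\begin{pmatrix}q_1 \\ a_1\end{pmatrix},\begin{pmatrix}q_2 \\ a_2\end{pmatrix}\in\mathcal F(\Lambda,\tau)$ have consecutive slopes if $\frac{a_1}{q_1}<\frac{a_2}{q_2}$ and no point of $\mathcal F(\Lambda,\tau)$ has slope strictly between them. Three points (in the given order) have consecutive slopes if the first and second do and the second and third do. *)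

(* Defs.v *)
From HB Require Import structures.
From mathcomp Require Import all_boot all_order all_algebra.
From mathcomp Require Import all_classical all_reals.

Set Implicit Arguments.
Unset Strict Implicit.
Unset Printing Implicit Defensive.

Import Order.TTheory GRing.Theory Num.Theory.
Local Open Scope classical_set_scope.
Local Open Scope ring_scope.

Definition vec2 (R : realType) (q a : R) : 'cV[R]_2 :=
  \col_(i < 2) (if i == 0 then q else a).

(* The columns of B are an R-basis of R^2 whose integer span is L. *)
Definition lattice_basis (R : realType) (L : set 'cV[R]_2) (B : 'M[R]_2) :=
  B \in unitmx /\ L = [set B *m map_mx intr z | z in [set: 'cV[int]_2]].

Definition lattice (R : realType) (L : set 'cV[R]_2) :=
  exists B : 'M[R]_2, lattice_basis L B.

(* Area of the fundamental parallelogram of some basis; two bases of L differ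
   by an integer matrix of determinant 1 or -1, so the choice is immaterial. *)
Definition has_covolume (R : realType) (L : set 'cV[R]_2) (c : R) :=
  exists2 B : 'M[R]_2, lattice_basis L B & `|\det B| = c.

Definition unimodular_lattice (R : realType) (L : set 'cV[R]_2) :=
  lattice L /\ has_covolume L 1.

Definition primitive_points (R : realType) (L : set 'cV[R]_2) : set 'cV[R]_2 :=
  [set v | [/\ L v, v != 0 &
    forall r : R, 0 <= r < 1 -> L (r *: v) -> r *: v = 0]].

Definition vstrip (R : realType) (tau : R) : set 'cV[R]_2 :=
  [set v | 0 < v 0 0 <= tau].

Definition farey_points (R : realType) (L : set 'cV[R]_2) (tau : R) :
    set 'cV[R]_2 :=
  primitive_points L `&` vstrip tau.

Definition slope (R : realType) (v : 'cV[R]_2) : R := v 1 0 / v 0 0.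

Definition consecutive_slopes (R : realType) (L : set 'cV[R]_2) (tau : R)
    (v w : 'cV[R]_2) :=
  slope v < slope w /\
  ~ exists2 u, farey_points L tau u & slope v < slope u < slope w.

Definition consecutive_slopes3 (R : realType) (L : set 'cV[R]_2) (tau : R)
    (u v w : 'cV[R]_2) :=
  consecutive_slopes L tau u v /\ consecutive_slopes L tau v w.

(* Main.v *)
(* Write v ^ w for the determinant of (v, w); on a unimodular lattice it takes
   integer values. If v, w have consecutive slopes then v ^ w = 1: complete the
   primitive v to a lattice basis (v, e), so w = m v + D e with D = v ^ w > 0.
   The lattice point u = (w + s v) / D, with 0 < s <= D and s = - m mod D, has
   s < D when D > 1 because w is primitive, so it lies in the strip with slope
   strictly between those of v and w. Moreover v + w is primitive and has an
   intermediate slope, so it must lie outside the strip. For three consecutive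
   points, v1 ^ v2 = v2 ^ v3 = 1 gives v1 + v3 = k v2 with k = v1 ^ v3, and the
   bounds q1, q3 <= tau < q1 + q2, q2 + q3 identify k with both floors. *)

Require Import Defs.
From HB Require Import structures.
From mathcomp Require Import all_boot all_order all_algebra.
From mathcomp Require Import all_classical all_reals.
From mathcomp Require Import ring lra.

Set Implicit Arguments.
Unset Strict Implicit.
Unset Printing Implicit Defensive.

Import Order.TTheory GRing.Theory Num.Theory.
Local Open Scope classical_set_scope.
Local Open Scope ring_scope.

Definition wedge (R : comNzRingType) (v w : 'cV[R]_2) : R :=
  v 0 0 * w 1 0 - v 1 0 * w 0 0.

Lemma wedge_mulmx (R : comNzRingType) (B : 'M[R]_2) (v w : 'cV[R]_2) :
  wedge (B *m v) (B *m w) = \det B * wedge v w.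
Proof.
have i1 : lift ord0 (ord0 : 'I_1) = 1 :> 'I_2 by apply: val_inj.
have i0 : lift (1 : 'I_2) (ord0 : 'I_1) = 0 by apply: val_inj.
have mulE (x : 'cV[R]_2) i : (B *m x) i 0 = B i 0 * x 0 0 + B i 1 * x 1 0.
  by rewrite mxE !big_ord_recl big_ord0 addr0 i1.
have detE : \det B = B 0 0 * B 1 1 - B 0 1 * B 1 0.
  rewrite (expand_det_row _ 0) !big_ord_recl big_ord0 i1 /cofactor.
  by rewrite !det_mx11 !mxE /= i1 i0 addr0 expr0 expr1 mul1r mulN1r mulrN.
by rewrite /wedge !mulE detE; ring.
Qed.

Lemma wedge_map_intr (R : comNzRingType) (x y : 'cV[int]_2) :
  wedge (map_mx intr x) (map_mx intr y) = (wedge x y)%:~R :> R.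
Proof. by rewrite /wedge !mxE -!intrM -intrB. Qed.

Lemma eq_cV2 (R : comNzRingType) (v w : 'cV[R]_2) :
  v 0 0 = w 0 0 -> v 1 0 = w 1 0 -> v = w.
Proof.
move=> e0 e1; apply/matrixP => i j; rewrite (ord1 j).
case: i => [[|[|//]]] lti.
- by rewrite (_ : Ordinal lti = 0) //; apply: val_inj.
- by rewrite (_ : Ordinal lti = 1) //; apply: val_inj.
Qed.

Lemma vec2_0 (R : realType) (q a : R) : vec2 q a 0 0 = q.
Proof. by rewrite mxE. Qed.

Lemma vec2_1 (R : realType) (q a : R) : vec2 q a 1 0 = a.
Proof. by rewrite mxE. Qed.

Lemma lattice_int_comb (R : realType) (L : set 'cV[R]_2) (v w : 'cV[R]_2)
    (m n : int) :
  lattice L -> L v -> L w -> L (m%:~R *: v + n%:~R *: w).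
Proof.
move=> [B [_ ->]] [x _ <-] [y _ <-]; exists (m *: x + n *: y) => //.
by rewrite map_mxD !map_mxZ mulmxDr -!scalemxAr.
Qed.

Lemma norm1_int (R : realDomainType) (x : R) :
  `|x| = 1 -> exists k : int, x = k%:~R.
Proof.
move=> x1; have [x0|x0] := leP 0 x.
  by exists 1; rewrite -x1 ger0_norm.
by exists (-1); rewrite intrN -x1 ltr0_norm // opprK.
Qed.

(** In integer coordinates the wedge is scaled by [\det B], which is 1 or -1. *)
Lemma unimodular_wedge_int (R : realType) (L : set 'cV[R]_2) (v w : 'cV[R]_2) :
  unimodular_lattice L -> L v -> L w -> exists n : int, wedge v w = n%:~R.
Proof.
move=> [_ [B [_ ->] /norm1_int[k detB]]] [x _ <-] [y _ <-].
by exists (k * wedge x y); rewrite wedge_mulmx wedge_map_intr detB intrM.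
Qed.

(** If the gcd [g] of the coordinates exceeded 1, scaling by [1/g] would give a nonzero lattice
    point on the open segment from the origin, against primitivity. *)
Lemma primitive_coprimez (R : realType) (L : set 'cV[R]_2) (B : 'M[R]_2)
    (x : 'cV[int]_2) :
  lattice_basis L B -> primitive_points L (B *m map_mx intr x) ->
  coprimez (x 0 0) (x 1 0).
Proof.
move=> [Bu LE] [_ nz prim].
set g := gcdz (x 0 0) (x 1 0).
have g0 : g != 0.
  rewrite gcdz_eq0; apply/negP => /andP[/eqP e0 /eqP e1].
  by case/eqP: nz; rewrite (_ : x = 0) ?map_mx0 ?mulmx0 //; apply: eq_cV2;
     rewrite ?e0 ?e1 mxE.
have gge1 : 1 <= g by rewrite -gtz0_ge1 lt_neqAle eq_sym g0.
rewrite /coprimez -/g eq_le gge1 andbT leNgt; apply/negP => gt1.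
have gR0 : g%:~R != 0 :> R by rewrite intr_eq0.
have [y xE] : exists y, x = g *: y.
  have /dvdzP[y0 e0] : (g %| x 0%R 0%R)%Z by apply: dvdz_gcdl.
  have /dvdzP[y1 e1] : (g %| x 1%R 0%R)%Z by apply: dvdz_gcdr.
  exists (\col_i (if i == 0 then y0 else y1)).
  by apply: eq_cV2; rewrite !mxE /= mulrC; [apply: e0 | apply: e1].
have rE : (g%:~R)^-1 *: (B *m map_mx intr x) = B *m map_mx intr y.
  by rewrite xE map_mxZ -scalemxAr scalerA mulVf // scale1r.
have := prim (g%:~R)^-1; rewrite rE => /(_ _ _) H.
have y0 : B *m map_mx intr y = 0.
  apply: H; last by rewrite LE; exists y.
  rewrite invr_ge0 ler0z (le_trans ler01 gge1) /= invf_lt1 ?ltr1z //.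
  by rewrite ltr0z (lt_trans _ gt1).
by case/eqP: nz; rewrite xE map_mxZ -scalemxAr y0 scaler0.
Qed.

(** Bezout coefficients of the coprime coordinates of [v] are the coordinates of [e], up to sign. *)
Lemma primitive_complement (R : realType) (L : set 'cV[R]_2) (v : 'cV[R]_2) :
  unimodular_lattice L -> primitive_points L v ->
  exists2 e, L e & wedge v e = 1.
Proof.
move=> [_ [B LB detB]] pv; have [Bu LE] := LB.
have [Lv _ _] := pv; rewrite LE in Lv; have [x _ xE] := Lv.
rewrite -xE in pv *; have /eqP cop := primitive_coprimez LB pv.
have [s [t st]] := Bezoutz (x 0 0) (x 1 0).
pose y : 'cV[int]_2 := \col_i (if i == 0 then - t else s).
have xy : wedge x y = 1.
  by rewrite /wedge !mxE /= -cop -st mulrN opprK mulrC [_ * t]mulrC.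
have LBz z : L (B *m map_mx intr z) by rewrite LE; exists z.
have dB : \det B * \det B = 1 by rewrite -expr2 -real_normK ?num_real // detB expr1n.
have [k kE] := norm1_int detB.
(* The basis [B] may be negatively oriented; the factor [k], equal to [\det B], corrects the sign
   since its square is 1. *)
exists (B *m map_mx intr (k *: y)) => //.
rewrite wedge_mulmx wedge_map_intr.
have -> : wedge x (k *: y) = k by rewrite -[RHS]mulr1 -xy /wedge !mxE; ring.
by rewrite -kE.
Qed.

(** If [r *: u] is a lattice point, then [r], being its wedge with [v], is an integer; the only one
    in [0, 1) is 0. *)
Lemma wedge1_primitive (R : realType) (L : set 'cV[R]_2) (v u : 'cV[R]_2) :
  unimodular_lattice L -> L v -> L u -> wedge v u = 1 -> primitive_points L u.
Proof.
move=> UL Lv Lu vu; split=> //.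
  apply/eqP => u0; move: vu; rewrite u0 /wedge !mxE !mulr0 subr0 => /eqP.
  by rewrite eq_sym oner_eq0.
move=> r /andP[r0 r1] Lru; have [n nE] := unimodular_wedge_int UL Lv Lru.
have rn : r = n%:~R.
  by rewrite -nE -[LHS]mulr1 -vu /wedge !mxE; ring.
move: r0 r1; rewrite rn ler0z ltrz1 => n0 n1.
suff -> : n = 0 by rewrite scale0r.
by apply/eqP; rewrite eq_le n0 andbT -ltzD1 add0r.
Qed.

Lemma slope_lt_wedge (R : realType) (v w : 'cV[R]_2) :
  0 < v 0 0 -> 0 < w 0 0 -> (slope v < slope w) = (0 < wedge v w).
Proof.
move=> v0 w0; rewrite /slope /wedge ltr_pdivrMr // mulrAC ltr_pdivlMr //.
by rewrite subr_gt0 [w 1 0 * _]mulrC.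
Qed.

Section Consecutive.
Variables (R : realType) (L : set 'cV[R]_2) (tau : R) (v w : 'cV[R]_2).
Hypotheses (UL : unimodular_lattice L).
Hypotheses (Fv : farey_points L tau v) (Fw : farey_points L tau w).
Hypothesis vw : consecutive_slopes L tau v w.

(** Such a [u] is primitive with slope strictly between those of [v] and [w], so only the strip can
    exclude it. *)
Let no_intermediate (u : 'cV[R]_2) :
  L u -> wedge v u = 1 -> 0 < wedge u w -> 0 < u 0 0 -> tau < u 0 0.
Proof.
move=> Lu vu uw u0; rewrite ltNge; apply/negP => utau.
have [[[Lv _ _] /andP[v0 _]] [_ /andP[w0 _]]] := (Fv, Fw).
case: vw => _; apply; exists u.
  by split; [exact: (wedge1_primitive UL Lv Lu vu) | apply/andP].
by rewrite !slope_lt_wedge // vu ltr01.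
Qed.

Lemma consecutive_wedge : wedge v w = 1.
Proof.
have [[pv /andP[v0 vtau]] [[Lw wn0 wprim] /andP[w0 wtau]]] := (Fv, Fw).
have [Lv _ _] := pv.
have [Lat _] := UL.
have [D DE] := unimodular_wedge_int UL Lv Lw.
have [e Le ve] := primitive_complement UL pv.
have [m mE] := unimodular_wedge_int UL Lw Le.
have D0 : 0 < D.
  by case: vw; rewrite slope_lt_wedge // DE ltr0z.
have [D1|D1] := leP D 1.
  by rewrite DE (_ : D = 1) //; apply/eqP; rewrite eq_le D1 -gtz0_ge1.
have DR : 0 < D%:~R :> R by rewrite ltr0z.
(* Cramer's rule in the basis [(v, e)] of determinant 1. *)
have wE : w = m%:~R *: v + D%:~R *: e.
  by apply: eq_cV2; rewrite -mE -DE !mxE -[LHS]mulr1 -ve /wedge; ring.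
have mD : (m %% D)%Z != 0.
  apply/eqP => mod0; have Em := divz_eq m D; rewrite mod0 addr0 in Em.
  have E : (D%:~R)^-1 *: w = ((m %/ D)%Z)%:~R *: v + 1%:~R *: e.
    rewrite wE {1}Em intrM scalerDr !scalerA mulrCA mulVf ?gt_eqF //.
    by rewrite mulr1.
  have Dw0 : (D%:~R)^-1 *: w = 0.
    apply: wprim; last by rewrite E; apply: lattice_int_comb.
    by rewrite invr_ge0 ltW //= invf_lt1 // ltr1z.
  by move/eqP: Dw0; rewrite scaler_eq0 invr_eq0 gt_eqF //= (negbTE wn0).
(* This is [(w + s v) / D], written in integer coordinates so that lattice membership is
   immediate. *)
pose u := ((m %/ D)%Z + 1)%:~R *: v + 1%:~R *: e.
have Lu : L u by apply: lattice_int_comb.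
pose s : R := (D - (m %% D)%Z)%:~R.
have s0 : 0 < s by rewrite ltr0z subr_gt0 ltz_pmod.
(* The nonzero remainder gains the 1 over the trivial bound [s <= D]. *)
have sD : s <= D%:~R - 1.
  rewrite /s intrB lerB // ler1z -gtz0_ge1 lt_neqAle eq_sym mD modz_ge0 //.
  by rewrite gt_eqF.
have sE : s = D%:~R * ((m %/ D)%Z + 1)%:~R - m%:~R.
  by rewrite {2}(divz_eq m D) /s -intrM -intrB; congr intr; ring.
have vu : wedge v u = 1 by rewrite -ve /u /wedge !mxE; ring.
have uw : wedge u w = s.
  transitivity (s * wedge v e); last by rewrite ve mulr1.
  by rewrite sE wE /u /wedge !mxE; ring.
have Du : D%:~R * u 0 0 = w 0 0 + s * v 0 0.
  by rewrite sE wE /u !mxE; ring.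
have u0 : 0 < u 0 0.
  by rewrite -(pmulr_rgt0 _ DR) Du addr_gt0 // mulr_gt0.
have := no_intermediate Lu vu; rewrite uw => /(_ s0 u0).
(* The bounds give [w 0 0 + s * v 0 0 <= tau + (D - 1) * tau], that is [D * tau], a
   contradiction. *)
rewrite -(ltr_pM2l DR) Du; nra.
Qed.

Lemma consecutive_width : tau < v 0 0 + w 0 0.
Proof.
have [[[Lv _ _] /andP[v0 _]] [[Lw _ _] /andP[w0 _]]] := (Fv, Fw).
have Lu : L (v + w).
  by have := lattice_int_comb 1 1 (proj1 UL) Lv Lw; rewrite !scale1r.
have := no_intermediate Lu.
rewrite mxE; apply; last exact: addr_gt0.
- by rewrite -consecutive_wedge /wedge !mxE; ring.
- suff -> : wedge (v + w) w = wedge v w by rewrite consecutive_wedge.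
  by rewrite /wedge !mxE; ring.
Qed.

End Consecutive.

Theorem theorem8 (R : realType) (L : set 'cV[R]_2) (tau : R)
    (q1 a1 q2 a2 q3 a3 : R) :
  unimodular_lattice L ->
  0 < tau ->
  farey_points L tau !=set0 ->
  farey_points L tau (vec2 q1 a1) ->
  farey_points L tau (vec2 q2 a2) ->
  farey_points L tau (vec2 q3 a3) ->
  consecutive_slopes3 L tau (vec2 q1 a1) (vec2 q2 a2) (vec2 q3 a3) ->
  [/\ vec2 q3 a3 =
        (Num.floor ((tau + q1) / q2))%:~R *: vec2 q2 a2 - vec2 q1 a1,
      vec2 q1 a1 =
        (Num.floor ((tau + q3) / q2))%:~R *: vec2 q2 a2 - vec2 q3 a3 &
      a2 / q2 = (a1 + a3) / (q1 + q3)].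
Proof.
move=> UL _ _ F1 F2 F3 [c12 c23].
have w12 := consecutive_wedge UL F1 F2 c12.
have w23 := consecutive_wedge UL F2 F3 c23.
have l12 := consecutive_width UL F1 F2 c12.
have l23 := consecutive_width UL F2 F3 c23.
case: (F1) (F2) (F3) => [[L1 _ _] b1] [_ b2] [[L3 _ _] b3].
have [k kE] := unimodular_wedge_int UL L1 L3.
rewrite /vstrip /= !vec2_0 in b1 b2 b3.
move: w12 w23 kE l12 l23; rewrite /wedge !vec2_0 !vec2_1 => w12 w23 kE l12 l23.
case/andP: b1 => q1_gt0 q1_le; case/andP: b2 => q2_gt0 _.
case/andP: b3 => q3_gt0 q3_le.
have qE : q1 + q3 = k%:~R * q2.
  (* First coordinate of the identity [(v2 ^ v3) v1 + (v1 ^ v2) v3 = (v1 ^ v3) v2], whose left-hand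
     wedges are both 1. *)
  transitivity (q1 * (q2 * a3 - a2 * q3) + q3 * (q1 * a2 - a1 * q2)).
    by rewrite w12 w23 !mulr1.
  by rewrite -kE; ring.
have aE : a1 + a3 = k%:~R * a2.
  transitivity (a1 * (q2 * a3 - a2 * q3) + a3 * (q1 * a2 - a1 * q2)).
    by rewrite w12 w23 !mulr1.
  by rewrite -kE; ring.
(* Since [q1 + q3] is [k * q2], dividing by [q2] puts the quotient in [k, k + 1). *)
have floorE q : q1 + q3 <= tau + q < q1 + q3 + q2 ->
    Num.floor ((tau + q) / q2) = k.
  move=> bq; apply: floor_def.
  by rewrite ler_pdivlMr // ltr_pdivrMr // intrD mulrDl mul1r -qE.
rewrite (floorE q1) ?(floorE q3); try by apply/andP; split; lra.
split.
- by apply: eq_cV2; rewrite !mxE /= -?qE -?aE; ring.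
- by apply: eq_cV2; rewrite !mxE /= -?qE -?aE; ring.
(* Cancelling [k] is legitimate because [k * q2 = q1 + q3] is positive. *)
- have k0 : k%:~R != 0 :> R.
    apply/eqP => k0; move: qE; rewrite k0 mul0r => qE; lra.
  by rewrite qE aE -mulf_div divff // mul1r.
Qed.
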